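(* Let $A$ be a unital commutative ring, let $\pi$ be an ideal of $A$, and let $n\geq 3$. Then the true elementary subgroup $\mathrm{F}_n(\pi)$ is normal in the subgroup $$\{g \in \mathrm{SL}_n(A) : g \bmod \pi \text{ is diagonal}\}$$ of $\mathrm{SL}_n(A)$.
   Context: For a unital commutative ring $A$, $a\in A$ and indices $i\neq j$ in $\{1,\dots,n\}$, the elementary matrix $e_{ij}(a)\in \mathrm{SL}_n(A)$ is $1_n+a e_{ij}$, where $1_n$ is the identity matrix and $e_{ij}$ is the matrix unit with $1$ in the $(i,j)$-entry and $0$ elsewhere. For an ideal $\pi$ of $A$, the true elementary subgroup $\mathrm{F}_n(\pi)$ is the subgroup of $\mathrm{SL}_n(A)$ generated by all $e_{ij}(a)$ with $a\in\pi$ and $i\neq j$. The condition ''$g \bmod \pi$ is diagonal'' means that all off-diagonal entries of $g$ lie in $\pi$. *)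

(* Defs.v *)
From HB Require Import structures.
From mathcomp Require Import all_boot all_order all_algebra.
From mathcomp Require Import classical_sets.

Set Implicit Arguments.
Unset Strict Implicit.
Unset Printing Implicit Defensive.

Import GRing.Theory.
Local Open Scope classical_set_scope.
Local Open Scope ring_scope.

(* Two-sided since the ring is commutative. [idealr] of ring_quotient is not
   used: it only covers proper ideals. *)
Definition is_ideal (A : comPzRingType) (I : set A) : Prop :=
  [/\ I 0, forall x y, I x -> I y -> I (x + y)
    & forall a x, I x -> I (a * x)].

Definition is_subgroup (G : groupType) (H : set G) : Prop :=
  [/\ H 1%g, forall x y, H x -> H y -> H (x * y)%g
    & forall x, H x -> H (x^-1)%g].

Definition generated_subgroup (G : groupType) (S : set G) : set G :=
  smallest (@is_subgroup G) S.

(* [x ^ h] is h^-1 * x * h. *)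
Definition is_normal_in (G : groupType) (N H : set G) : Prop :=
  [/\ is_subgroup N, is_subgroup H, N `<=` H
    & forall x h, N x -> H h -> N (x ^ h)%g].

Section SpecialLinear.
Variables (A : comPzRingType) (n : nat).

(* No unit structure on [A] is assumed, so the group inverse is the adjugate. *)
Record SL := MkSL { SLval :> 'M[A]_n; _ : \det SLval == 1 }.

HB.instance Definition _ := [isSub for SLval].
HB.instance Definition _ := [Choice of SL by <:].

Lemma SL_det (g : SL) : \det g = 1.
Proof. exact/eqP/(valP g). Qed.

Lemma SL_one_subproof : \det (1%:M : 'M[A]_n) == 1.
Proof. by rewrite det1. Qed.

Lemma SL_mul_subproof (g h : SL) : \det (SLval g *m SLval h) == 1.
Proof. by rewrite det_mulmx !SL_det mulr1. Qed.

Lemma SL_inv_subproof (g : SL) : \det (\adj (SLval g)) == 1.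
Proof.
have := congr1 determinant (mul_mx_adj g).
by rewrite det_mulmx SL_det mul1r det1 => ->.
Qed.

Definition SL_one : SL := MkSL SL_one_subproof.
Definition SL_mul (g h : SL) : SL := MkSL (SL_mul_subproof g h).
Definition SL_inv (g : SL) : SL := MkSL (SL_inv_subproof g).

Lemma SL_mulA : associative SL_mul.
Proof. by move=> f g h; apply: val_inj; rewrite /= mulmxA. Qed.

Lemma SL_mul1 : left_id SL_one SL_mul.
Proof. by move=> g; apply: val_inj; rewrite /= mul1mx. Qed.

Lemma SL_mulr1 : right_id SL_one SL_mul.
Proof. by move=> g; apply: val_inj; rewrite /= mulmx1. Qed.

Lemma SL_mulV : left_inverse SL_one SL_inv SL_mul.
Proof. by move=> g; apply: val_inj; rewrite /= mul_adj_mx SL_det. Qed.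

Lemma SL_mulrV : right_inverse SL_one SL_inv SL_mul.
Proof. by move=> g; apply: val_inj; rewrite /= mul_mx_adj SL_det. Qed.

HB.instance Definition _ :=
  isGroup.Build SL SL_mulA SL_mul1 SL_mulr1 SL_mulV SL_mulrV.

Definition elementary_mx (i j : 'I_n) (a : A) : 'M[A]_n :=
  1%:M + a *: delta_mx i j.

Lemma det_elementary_mx (i j : 'I_n) (a : A) :
  i != j -> \det (elementary_mx i j a) == 1.
Proof.
have trig (k l : 'I_n) : (l < k)%N -> \det (elementary_mx k l a) == 1.
  move=> lk; rewrite det_trig.
    apply/eqP/big1 => p _; rewrite !mxE eqxx.
    have [->|_] := eqVneq p k; last by rewrite mulr0 addr0.
    by rewrite -(inj_eq val_inj) gtn_eqF // mulr0 addr0.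
  apply/is_trig_mxP => p q pq; rewrite !mxE -(inj_eq val_inj) ltn_eqF // add0r.
  have [pk|_] := eqVneq p k; last by rewrite mulr0.
  have [ql|_] := eqVneq q l; last by rewrite mulr0.
  by rewrite pk ql ltnNge (ltnW lk) in pq.
rewrite -(inj_eq val_inj) neq_ltn => /orP[ij|]; last exact: trig.
rewrite -det_tr; suff -> : (elementary_mx i j a)^T = elementary_mx j i a.
  exact: trig.
by rewrite /elementary_mx linearD /= linearZ /= trmx1 trmx_delta.
Qed.

Definition elementary (i j : 'I_n) (ij : i != j) (a : A) : SL :=
  MkSL (det_elementary_mx a ij).

Definition true_elementary_subgroup (I : set A) : set SL :=
  generated_subgroup
    [set g | exists (i j : 'I_n) (ij : i != j) (a : A),
               I a /\ g = elementary ij a].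

Definition SL_diagonal_mod (I : set A) : set SL :=
  [set g | forall i j : 'I_n, i != j -> I (g i j)].

End SpecialLinear.

Arguments true_elementary_subgroup {A} n I.
Arguments SL_diagonal_mod {A} n I.

(* Main.v *)
Require Import Defs.
From mathcomp Require Import all_boot all_order all_algebra.
From mathcomp Require Import classical_sets.

(** Suslin's proof of the normality of elementary subgroups, carried out inside
    the subgroup generated by the [elementary_mx i j a] with [a] in [I].

    Let [h] be diagonal modulo [I], and [a] in [I].  The conjugate of
    [elementary_mx i j a] by [h] is the transvection [1 + a v w], where [v] is
    column [i] of [h^-1] and [w] is row [j] of [h].  Here [w v = 0], the column
    [v] is unimodular, and its entries lie in [I] except possibly the [i]-th.
    Unimodularity makes [w] a combination of the Koszul rows [v_l f_k - v_k f_l]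
    ([koszul_row_decomposition]).  As all of these kill [v], [1 + a v w] is the
    product of transvections [1 + b v (v_l f_k - v_k f_l)] with [b] in [I]
    ([true_elementary_transvection]), and it suffices to treat each of them.

    Such a factor is, up to elementary matrices over [I], a two by two block in
    the rows and columns [k] and [l] ([true_elementary_koszul]).  With a third
    index the block is a commutator of elementary matrices, but of matrices over
    [A], which settles the matter only for subgroups stable under conjugation by
    those.  At least one of [v_k], [v_l] is in [I], however, and then the
    block can be rewritten with coefficients in [I] ([true_elementary_block]).

    The matrices diagonal modulo [I] form a subgroup because the adjugate
    preserves that condition ([adj_diagonal_mod]). *)

Set Implicit Arguments.
Unset Strict Implicit.
Unset Printing Implicit Defensive.

Import GRing.Theory.
Local Open Scope ring_scope.

Lemma exists_third_index n (k l : 'I_n) :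
  (2 < n)%N -> exists m : 'I_n, m != k /\ m != l.
Proof.
move=> n3; have /card_gt0P[m] : (0 < #|~: [set k; l]|)%N.
  rewrite -(ltn_add2l #|[set k; l]|) cardsC card_ord addn0.
  by apply: leq_ltn_trans n3; rewrite cards2; case: (k != l).
by rewrite !inE negb_or => /andP[mk ml]; exists m.
Qed.

Lemma generated_subgroup_is_subgroup (G : groupType) (S : set G) :
  is_subgroup (generated_subgroup S).
Proof.
split=> [H [[H1 _ _] _] //|x y Sx Sy H HS|x Sx H HS]; case: (HS) => [[_ HM HV] _].
  by apply: HM; [apply: Sx | apply: Sy].
by apply: HV; apply: Sx.
Qed.

(** * Transvections and Koszul rows *)

Section Transvections.
Variables (A : comPzRingType) (n : nat).
Implicit Types (v p x : 'cV[A]_n) (w q y : 'rV[A]_n) (M N : 'M[A]_n).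

Definition transvection v w : 'M[A]_n := 1%:M + v *m w.

Lemma transvection_mul v w p q :
  w *m p = 0 ->
  transvection v w *m transvection p q = 1%:M + v *m w + p *m q.
Proof.
move=> wp0; rewrite /transvection mulmxDr mulmx1 mulmxDl mul1mx.
by rewrite -(mulmxA v) (mulmxA w) wp0 mul0mx mulmx0 addr0.
Qed.

Lemma transvectionDr v w q :
  w *m v = 0 -> transvection v (w + q) = transvection v w *m transvection v q.
Proof.
by move=> wv0; rewrite transvection_mul // /transvection mulmxDr addrA.
Qed.

Lemma transvectionDl v p w :
  w *m p = 0 -> transvection (v + p) w = transvection v w *m transvection p w.
Proof.
by move=> wp0; rewrite transvection_mul // /transvection mulmxDl addrA.
Qed.

Lemma transvectionZ b v w : transvection (b *: v) w = transvection v (b *: w).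
Proof. by rewrite /transvection -scalemxAl scalemxAr. Qed.

Lemma transvection0r v : transvection v 0 = 1%:M.
Proof. by rewrite /transvection mulmx0 addr0. Qed.

Lemma transvection0l w : transvection 0 w = 1%:M.
Proof. by rewrite /transvection mul0mx addr0. Qed.

Lemma transvection_conj M N v w :
  M *m N = 1%:M ->
  M *m transvection v w *m N = transvection (M *m v) (w *m N).
Proof.
by move=> MN; rewrite /transvection mulmxDr mulmx1 mulmxDl MN !mulmxA.
Qed.

Lemma transvectionN v w :
  w *m v = 0 -> transvection v w *m transvection (- v) w = 1%:M.
Proof.
by move=> wv0; rewrite -transvectionDl ?addrN ?transvection0l // mulmxN wv0 oppr0.
Qed.

Lemma cV_sum_delta v : v = \sum_k v k 0 *: delta_mx k 0.
Proof. by rewrite {1}[v]matrix_sum_delta; apply: eq_bigr => k _; rewrite big_ord1. Qed.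

Lemma delta_mul_delta (i j : 'I_n) :
  delta_mx 0 i *m delta_mx j 0 = (i == j)%:R%:M :> 'M[A]_1.
Proof. by rewrite -rowE; apply/matrixP => a b; rewrite !mxE !ord1 !eqxx andbT mulr1n. Qed.

Lemma transvection_delta i j a :
  transvection (delta_mx i 0) (a *: delta_mx 0 j) = elementary_mx i j a.
Proof. by rewrite /transvection -scalemxAr mul_delta_mx. Qed.

(** Expanding [[1 + p y, 1 + x q]] with [y x = 1] and every other product of a
    row by a column equal to [0] leaves only the term [p (y x) q]. *)
Lemma transvection_commutator p q x y :
  q *m p = 0 -> y *m p = 0 -> q *m x = 0 -> y *m x = 1%:M ->
  transvection p q =
    transvection p y *m transvection x q *m transvection (- p) y
      *m transvection x (- q).
Proof.
move=> qp yp qx yx.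
have -> : transvection p y *m transvection x q *m transvection (- p) y
          = transvection (x + p) q.
  rewrite transvection_conj; last exact: transvectionN.
  congr transvection; rewrite /transvection.
    by rewrite mulmxDl mul1mx -mulmxA yx mulmx1.
  by rewrite mulmxDr mulmx1 mulmxA mulmxN qp oppr0 mul0mx addr0.
rewrite addrC transvectionDl // -mulmxA -transvectionDr //.
by rewrite subrr transvection0r mulmx1.
Qed.

(** The basic relations between the entries of [v], one for each pair of
    indices; they form the differential of the Koszul complex of [v]. *)
Definition koszul_row v k l : 'rV[A]_n :=
  v l 0 *: delta_mx 0 k - v k 0 *: delta_mx 0 l.

Lemma koszul_row_mul v p k l :
  koszul_row v k l *m p = (v l 0 * p k 0 - v k 0 * p l 0)%:M.
Proof.
rewrite /koszul_row mulmxBl -!scalemxAl -!rowE.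
by apply/matrixP => a b; rewrite !mxE !ord1 eqxx.
Qed.

Lemma koszul_row_self v k l : koszul_row v k l *m v = 0.
Proof. by rewrite koszul_row_mul mulrC subrr raddf0. Qed.

Lemma koszul_rowC v k l : koszul_row v l k = - koszul_row v k l.
Proof. by rewrite /koszul_row opprB. Qed.

Lemma koszul_row_diag v k : koszul_row v k k = 0.
Proof. exact: subrr. Qed.

(** The Koszul complex of a unimodular column is exact, in the form used by
    Suslin: modulo [w *m v = 0], multiplying [w] by [1 = u *m v] rewrites it
    through the rows [koszul_row v k l].  Summing over all ordered pairs avoids
    an ordering of the indices. *)
Lemma koszul_row_decomposition v u w :
  u *m v = 1%:M -> w *m v = 0 ->
  w = \sum_k \sum_l (w 0 k * u 0 l) *: koszul_row v k l.
Proof.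
move=> /(congr1 (fun M : 'M_1 => M 0 0)) uv /(congr1 (fun M : 'M_1 => M 0 0)) wv.
rewrite !mxE mulr1n in uv; rewrite !mxE in wv.
rewrite /koszul_row; under eq_bigr => k _ do
  under eq_bigr => l _ do rewrite scalerBr !scalerA -mulrA mulrAC.
under eq_bigr do rewrite sumrB.
rewrite sumrB -[LHS]subr0; congr (_ - _).
  rewrite {1}[w]row_sum_delta; apply: eq_bigr => k _.
  by rewrite -scaler_suml -mulr_sumr uv mulr1.
rewrite exchange_big big1 //= => l _.
by rewrite -scaler_suml -mulr_suml wv mul0r scale0r.
Qed.
End Transvections.

(** * Matrices that are diagonal modulo an ideal *)

Section Ideal.
Variables (A : comPzRingType) (I : set A).
Hypothesis hI : is_ideal I.

Lemma ideal0 : I 0. Proof. by case: hI. Qed.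
Lemma idealD a b : I a -> I b -> I (a + b). Proof. by case: hI => _ + _; apply. Qed.
Lemma idealMl a b : I b -> I (a * b). Proof. by case: hI => _ _; apply. Qed.
Lemma idealMr a b : I a -> I (a * b). Proof. by rewrite mulrC; apply: idealMl. Qed.
Lemma idealN a : I a -> I (- a). Proof. by rewrite -mulN1r; apply: idealMl. Qed.
Lemma ideal_sum (J : finType) (P : pred J) (F : J -> A) :
  (forall j, P j -> I (F j)) -> I (\sum_(j | P j) F j).
Proof. by move=> IF; apply: big_ind => //; [apply: ideal0 | apply: idealD]. Qed.

Lemma ideal_det n (M : 'M[A]_n) i : (forall j, I (M i j)) -> I (\det M).
Proof.
by move=> IM; rewrite (expand_det_row M i); apply: ideal_sum => j _; apply: idealMr.
Qed.

(** For [i != j], the minor of [M] that computes [(\adj M) i j] omits row [j]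
    and column [i], so it keeps row [i] but without its diagonal entry: a whole
    row of the minor lies in [I]. *)
Lemma adj_diagonal_mod n (M : 'M[A]_n) :
  (forall i j, i != j -> I (M i j)) -> forall i j, i != j -> I ((\adj M) i j).
Proof.
move=> IM i j ij; rewrite mxE /cofactor; apply: idealMl.
case: (unliftP j i) => [i' def_i|ji]; last by rewrite ji eqxx in ij.
by apply: (@ideal_det _ _ i') => c; rewrite !mxE -def_i; apply/IM/neq_lift.
Qed.

Lemma SL_diagonal_mod_is_subgroup n : is_subgroup (SL_diagonal_mod n I).
Proof.
split=> [i j ij|g h Dg Dh i j ij|g Dg i j ij].
- by rewrite mxE (negPf ij); apply: ideal0.
- rewrite mxE; apply: ideal_sum => k _.
  have [ik|ik] := eqVneq i k; last by apply/idealMr/Dg.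
  by apply/idealMl/Dh; rewrite -ik.
- exact: adj_diagonal_mod.
Qed.

Lemma elementary_diagonal_mod n (i j : 'I_n) (ij : i != j) a :
  I a -> SL_diagonal_mod n I (elementary ij a).
Proof.
move=> Ia k l kl; rewrite !mxE (negPf kl) add0r.
by apply: idealMr.
Qed.
End Ideal.

(** * Transvections in the true elementary subgroup *)

Section TrueElementary.
Variables (A : comPzRingType) (I : set A) (n : nat).
Hypothesis hI : is_ideal I.
Implicit Types (v p x : 'cV[A]_n) (w q y : 'rV[A]_n) (M N : 'M[A]_n).

(** The subgroup is carried over to matrices so that products of transvections
    can be handled by matrix algebra, with no determinant to track. *)
Definition true_elementary_mx M : Prop :=
  exists2 g : SL A n, true_elementary_subgroup n I g & SLval g = M.
Local Notation F := true_elementary_mx.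

Lemma true_elementary_is_subgroup :
  is_subgroup (true_elementary_subgroup n I).
Proof. exact: generated_subgroup_is_subgroup. Qed.

Lemma true_elementary_mx1 : F 1%:M.
Proof. by case: true_elementary_is_subgroup => F1 _ _; exists 1%g. Qed.

Lemma true_elementary_mxM M N : F M -> F N -> F (M *m N).
Proof.
case: true_elementary_is_subgroup => _ FM _ [g Fg <-] [h Fh <-].
by exists (g * h)%g => //; apply: FM.
Qed.

Lemma true_elementary_mx_elementary i j a :
  i != j -> I a -> F (elementary_mx i j a).
Proof.
move=> ij Ia; exists (elementary ij a) => // H [_]; apply.
by exists i, j, ij, a.
Qed.

Lemma true_elementary_sumr (J : finType) (P : pred J) v (w : J -> 'rV_n) :
  (forall j, P j -> w j *m v = 0) -> (forall j, P j -> F (transvection v (w j))) ->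
  F (transvection v (\sum_(j | P j) w j)).
Proof.
move=> wv Fw; suff [] : (\sum_(j | P j) w j) *m v = 0
  /\ F (transvection v (\sum_(j | P j) w j)) by [].
apply: (big_ind (fun r => r *m v = 0 /\ F (transvection v r))).
- by rewrite mul0mx transvection0r; split=> //; apply: true_elementary_mx1.
- move=> r s [rv Fr] [sv Fs]; rewrite mulmxDl rv sv addr0 transvectionDr //.
  by split=> //; apply: true_elementary_mxM.
- by move=> j Pj; split; [apply: wv | apply: Fw].
Qed.

Lemma true_elementary_suml (J : finType) (P : pred J) (v : J -> 'cV_n) w :
  (forall j, P j -> w *m v j = 0) -> (forall j, P j -> F (transvection (v j) w)) ->
  F (transvection (\sum_(j | P j) v j) w).
Proof.
move=> wv Fw; suff [] : w *m (\sum_(j | P j) v j) = 0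
  /\ F (transvection (\sum_(j | P j) v j) w) by [].
apply: (big_ind (fun r => w *m r = 0 /\ F (transvection r w))).
- by rewrite mulmx0 transvection0l; split=> //; apply: true_elementary_mx1.
- move=> r s [rv Fr] [sv Fs]; rewrite mulmxDr rv sv addr0 transvectionDl //.
  by split=> //; apply: true_elementary_mxM.
- by move=> j Pj; split; [apply: wv | apply: Fw].
Qed.

Lemma true_elementary_row j q :
  (forall k, I (q 0 k)) -> q 0 j = 0 -> F (transvection (delta_mx j 0) q).
Proof.
move=> Iq qj; rewrite [q]row_sum_delta (bigD1 j) //= qj scale0r add0r.
apply: true_elementary_sumr => k kj.
  by rewrite -scalemxAl delta_mul_delta (negPf kj) raddf0 scaler0.
by rewrite transvection_delta; apply: true_elementary_mx_elementary; rewrite // eq_sym.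
Qed.

Lemma true_elementary_col j p :
  (forall k, I (p k 0)) -> p j 0 = 0 -> F (transvection p (delta_mx 0 j)).
Proof.
move=> Ip pj; rewrite [p]cV_sum_delta (bigD1 j) //= pj scale0r add0r.
apply: true_elementary_suml => k kj.
  by rewrite -scalemxAr delta_mul_delta eq_sym (negPf kj) raddf0 scaler0.
by rewrite transvectionZ transvection_delta; apply: true_elementary_mx_elementary.
Qed.

(** The index [j], at which [p] and [q] both vanish, leaves room for the auxiliary
    column [e_j] and row [f_j] of [transvection_commutator]; the four factors of
    the commutator then only involve the entries of [p] and [q]. *)
Lemma true_elementary_commutator j p q :
  (forall k, I (p k 0)) -> p j 0 = 0 -> (forall k, I (q 0 k)) -> q 0 j = 0 ->
  q *m p = 0 -> F (transvection p q).
Proof.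
move=> Ip pj Iq qj qp.
rewrite (transvection_commutator (x := delta_mx j 0) (y := delta_mx 0 j)) //.
- do 3?apply: true_elementary_mxM.
  + exact: true_elementary_col.
  + exact: true_elementary_row.
  + by apply: true_elementary_col => [k|]; rewrite mxE ?pj ?oppr0 //; apply: idealN.
  + by apply: true_elementary_row => [k|]; rewrite mxE ?qj ?oppr0 //; apply: idealN.
- by rewrite -rowE; apply/matrixP => a b; rewrite !ord1 !mxE.
- by rewrite -colE; apply/matrixP => a b; rewrite !ord1 !mxE.
- by rewrite delta_mul_delta eqxx.
Qed.

(** The core of the proof, and the place where a third index [m] is
    needed.  If [s] were [1], the matrix would be the conjugate of
    [elementary_mx i j (- b)] by [elementary_mx j i t]; for general [s] this is
    not available.  Write [e_k], [f_k] for the standard columns and rows and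
    [x], [y] for the column and the row of the statement.  As [y] kills [x] and
    [e_m], adding [b e_m] to the column only costs a factor in the subgroup.
    Then [x + e_m = s e_i + t e_j + e_m], and undoing a conjugation by
    [elementary_mx j m t] clears the coordinate [j]: the column becomes
    [b (e_m + s e_i)] and the row becomes [t (f_i - s f_m) - s f_j].  The two
    parts of this row kill that column; the first yields a transvection with
    both vectors in [I] and zero at [j], hence a commutator, and the
    second an element with a single nontrivial column. *)
Lemma true_elementary_block i j m b s t :
  i != j -> m != i -> m != j -> I b -> I t ->
  F (transvection (b *: (s *: delta_mx i 0 + t *: delta_mx j 0))
                  (t *: delta_mx 0 i - s *: delta_mx 0 j)).
Proof.
move=> ij mi mj Ib It; set x := _ + _; set y := _ - _.
have ji : j == i = false by rewrite eq_sym (negPf ij).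
have im : i == m = false by rewrite eq_sym (negPf mi).
have jm : j == m = false by rewrite eq_sym (negPf mj).
have yem : y *m (delta_mx m 0 : 'cV_n) = 0.
  by rewrite /y mulmxBl -!scalemxAl !delta_mul_delta im jm raddf0 !scaler0 subrr.
have ym : y 0 m = 0 by rewrite !mxE !eqxx eq_sym im eq_sym jm !mulr0 subrr.
have Iby k : I (b * y 0 k) by apply: idealMr.
pose e := delta_mx m 0 + s *: delta_mx i 0 : 'cV[A]_n.
pose f := delta_mx 0 i - s *: delta_mx 0 m : 'rV[A]_n.
have fe : f *m e = 0.
  rewrite /f /e mulmxBl !mulmxDr -!scalemxAl -!scalemxAr !delta_mul_delta.
  by rewrite !eqxx im (negPf mi) raddf0 !scaler0 add0r addr0 subrr.
have fme : (delta_mx 0 m : 'rV_n) *m e = 1%:M.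
  by rewrite /e mulmxDr -scalemxAr !delta_mul_delta eqxx (negPf mi) raddf0 scaler0 addr0.
have fje : (delta_mx 0 j : 'rV_n) *m e = 0.
  by rewrite /e mulmxDr -scalemxAr !delta_mul_delta jm ji raddf0 scaler0 addr0.
have Ie k : I ((b *: e) k 0) by rewrite mxE; apply: idealMr.
have ej : e j 0 = 0 by rewrite !mxE jm ji !eqxx mulr0 addr0.
have fj : f 0 j = 0 by rewrite !mxE ji jm !eqxx mulr0 subr0.
have inner : F (transvection (b *: e) (t *: f - s *: delta_mx 0 j)).
  rewrite transvectionDr; last by rewrite -scalemxAl -scalemxAr fe !scaler0.
  apply: true_elementary_mxM.
    apply: (true_elementary_commutator (j := j)) => //.
    - by rewrite mxE ej mulr0.
    - by move=> k; rewrite mxE; apply: idealMr.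
    - by rewrite mxE fj mulr0.
    - by rewrite -scalemxAl -scalemxAr fe !scaler0.
  rewrite -scaleNr -transvectionZ; apply: true_elementary_col => [k|].
    by rewrite mxE; apply: idealMl.
  by rewrite scalerA mxE ej mulr0.
have outer : F (transvection (b *: (x + delta_mx m 0)) y).
  pose E := transvection (delta_mx j 0) (t *: delta_mx 0 m).
  pose E' := transvection (delta_mx j 0) (- (t *: delta_mx 0 m)).
  have mjz : (t *: delta_mx 0 m) *m delta_mx j 0 = 0 :> 'M[A]_1.
    by rewrite -scalemxAl delta_mul_delta (negPf mj) raddf0 scaler0.
  have EE' : E *m E' = 1%:M by rewrite -transvectionDr // subrr transvection0r.
  have -> : b *: (x + delta_mx m 0) = E *m (b *: e).
    rewrite -scalemxAr; congr (_ *: _).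
    rewrite /E /transvection mulmxDl mul1mx -mulmxA -scalemxAl fme.
    rewrite scale_scalar_mx mulr1 mul_mx_scalar /x /e.
    by rewrite addrC addrA.
  have -> : y = (t *: f - s *: delta_mx 0 j) *m E'.
    have zj : (t *: f - s *: delta_mx 0 j) *m (delta_mx j 0 : 'cV_n) = (- s)%:M.
      rewrite -colE; apply/matrixP => c d; rewrite !ord1 !mxE !eqxx ji jm.
      by rewrite !mulr0 subrr mulr0 mulr1 sub0r.
    rewrite /E' /transvection mulmxDr mulmx1 mulmxA zj mul_scalar_mx.
    rewrite scalerN scaleNr opprK scalerBr !scalerA (mulrC t) /y.
    by rewrite addrAC subrK.
  rewrite -transvection_conj //.
  apply: true_elementary_mxM; first apply: true_elementary_mxM => //.
    rewrite /E transvection_delta.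
    by apply: true_elementary_mx_elementary; rewrite ?jm.
  rewrite /E' -scaleNr transvection_delta.
  by apply: true_elementary_mx_elementary; rewrite ?jm //; apply: idealN.
have -> : transvection (b *: x) y
    = transvection (b *: (x + delta_mx m 0)) y *m transvection (- delta_mx m 0) (b *: y).
  rewrite -transvectionZ -transvectionDl; last first.
    by rewrite -scalemxAr mulmxN yem oppr0 scaler0.
  by rewrite scalerN [b *: (x + _)]scalerDr addrK.
apply: true_elementary_mxM => //.
rewrite -scaleN1r transvectionZ; apply: true_elementary_row => [k|].
  by rewrite scalerA mxE -mulrA; apply: idealMl.
by rewrite scalerA mxE ym mulr0.
Qed.

(** The row is supported on [k] and [l].  The part of [v] on these two indices
    gives a two by two block, and each remaining coordinate of [v] is killed by
    the row and gives a row of elements of [I], thanks to [b].  So [v l] is the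
    only entry of [v] that has to be in [I]. *)
Lemma true_elementary_koszul v k l b :
  (2 < n)%N -> k != l -> I (v l 0) -> I b ->
  F (transvection (b *: v) (koszul_row v k l)).
Proof.
move=> n3 kl Ivl Ib; have [m [mk ml]] := exists_third_index k l n3.
have rv0 (c : A) p : p k 0 = 0 -> p l 0 = 0 -> koszul_row v k l *m (c *: p) = 0.
  by move=> pk pl; rewrite -scalemxAr koszul_row_mul pk pl !mulr0 subrr raddf0 scaler0.
have delta0 a c d : a != c -> (d *: delta_mx c 0 : 'cV[A]_n) a 0 = 0.
  by move=> ac; rewrite !mxE (negPf ac) mulr0.
rewrite [v in b *: v]cV_sum_delta (bigD1 k) //= (bigD1 l) 1?eq_sym //= addrA.
rewrite scalerDr transvectionDl; last first.
  apply: rv0; rewrite summxE big1 // => c /andP[ck cl].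
    by rewrite delta0 // eq_sym.
  by rewrite delta0 // eq_sym.
apply: true_elementary_mxM; first exact: (true_elementary_block (m := m)).
rewrite scaler_sumr; apply: true_elementary_suml => c /andP[ck cl].
  by apply: rv0; apply: delta0; rewrite eq_sym.
rewrite scalerA transvectionZ; apply: true_elementary_row => [a|].
  by rewrite mxE -mulrA; apply: idealMr.
by rewrite !mxE (negPf ck) (negPf cl) !andbF !mulr0 subrr mulr0.
Qed.

(** Among two distinct indices [k] and [l] at least one differs from [i], so that
    one of [v k], [v l] lies in [I]; by antisymmetry of [koszul_row] it can be
    taken to be [v l].  All the products of transvections that occur commute,
    since every Koszul row kills [v]. *)
Lemma true_elementary_transvection i v u w a :
  (2 < n)%N -> (forall k, k != i -> I (v k 0)) ->
  u *m v = 1%:M -> w *m v = 0 -> I a -> F (transvection (a *: v) w).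
Proof.
move=> n3 Iv uv wv Ia; rewrite (koszul_row_decomposition uv wv).
have kv0 c k l : c *: koszul_row v k l *m (a *: v) = 0.
  by rewrite -scalemxAl -scalemxAr koszul_row_self !scaler0.
apply: true_elementary_sumr => k _.
  by rewrite mulmx_suml big1.
apply: true_elementary_sumr => l _; first exact: kv0.
rewrite -transvectionZ scalerA.
have [<-|kl] := eqVneq k l.
  by rewrite koszul_row_diag transvection0r; apply: true_elementary_mx1.
have [li|li] := eqVneq l i; last first.
  by apply: true_elementary_koszul => //; [apply: Iv | apply: idealMl].
rewrite koszul_rowC -scaleN1r -transvectionZ scalerA.
apply: true_elementary_koszul; rewrite 1?eq_sym //.
  by apply: Iv; rewrite -li.
by rewrite mulrA; apply: idealMl.
Qed.

(** Conjugating by [h] turns the matrix unit into the product of column [i] of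
    [h^-1] and row [j] of [h]; row [i] of [h] shows that this column is
    unimodular, and row [j] kills it because [i != j]. *)
Lemma true_elementary_conj_elementary i j (ij : i != j) a (h : SL A n) :
  (2 < n)%N -> I a -> SL_diagonal_mod n I h ->
  true_elementary_subgroup n I (elementary ij a ^ h)%g.
Proof.
move=> n3 Ia Dh.
have Dh' : SL_diagonal_mod n I (h^-1)%g.
  by case: (SL_diagonal_mod_is_subgroup hI n) => _ _; apply.
have hh' : SLval h *m SLval (h^-1)%g = 1%:M by rewrite mul_mx_adj SL_det.
have h'h : SLval (h^-1)%g *m SLval h = 1%:M by rewrite mul_adj_mx SL_det.
suff [g Fg gE] : F (SLval (elementary ij a ^ h)%g).
  by rewrite -(val_inj gE : g = _).
have -> : SLval (elementary ij a ^ h)%g =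
    SLval (h^-1)%g *m elementary_mx i j a *m SLval h.
  by rewrite conjgE /= mulmxA.
rewrite -transvection_delta transvection_conj // -scalemxAl -transvectionZ.
rewrite -rowE -colE.
apply: (@true_elementary_transvection i _ (row i (SLval h))) => //.
- by move=> k ki; rewrite mxE; exact: (Dh' k i ki).
- rewrite rowE colE mulmxA -(mulmxA (delta_mx 0 i)) hh' mulmx1.
  by rewrite delta_mul_delta eqxx.
- rewrite rowE colE mulmxA -(mulmxA (delta_mx 0 j)) hh' mulmx1.
  by rewrite delta_mul_delta eq_sym (negPf ij) raddf0.
Qed.
End TrueElementary.

Theorem theorem2 (A : comPzRingType) (I : set A) (n : nat)
    (hI : is_ideal I) (hn : (3 <= n)%N) :
  is_normal_in (true_elementary_subgroup n I) (SL_diagonal_mod n I).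
Proof.
have [D1 DM DV] := SL_diagonal_mod_is_subgroup hI n.
have [F1 FM FV] := true_elementary_is_subgroup I n.
split=> // [g Fg|g h Fg Dh].
  by apply: Fg; split=> // _ [i [j [ij [a [Ia ->]]]]]; apply: elementary_diagonal_mod.
apply: (Fg (fun x => true_elementary_subgroup n I (x ^ h)%g)); split.
  split=> [|x y Fx Fy|x Fx].
  - by rewrite conj1g.
  - by rewrite conjMg; apply: FM.
  - by rewrite conjVg; apply: FV.
by move=> _ [i [j [ij [a [Ia ->]]]]]; apply: true_elementary_conj_elementary.
Qed.
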